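(* Let $P$ be the Borel probability measure on $\mathbb{R}$ with $P(\{1/k\})=2^{-k}$ for every $k\in\mathbb{N}=\{1,2,3,\dots\}$. (a) For every integer $n$ with $1\le n\le 5$, the set $\{Av[n,\infty),\tfrac1{n-1},\dots,\tfrac13,\tfrac12,1\}$ (that is, $\{Av[n,\infty)\}\cup\{\tfrac1j:1\le j\le n-1\}$) is the optimal set of $n$-means for $P$, with $n$th quantization error $V_n(P)=Er[n,\infty)$. (b) For every integer $n$ with $6\le n\le 300$, the set $\{Av[n+1,\infty),Av[n-1,n],\tfrac1{n-2},\dots,\tfrac13,\tfrac12,1\}$ (that is, $\{Av[n+1,\infty),Av[n-1,n]\}\cup\{\tfrac1j:1\le j\le n-2\}$) is the optimal set of $n$-means for $P$, with $n$th quantization error $V_n(P)=Er[n+1,\infty)+Er[n-1,n]$.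
   Context: For a Borel probability measure $P$ on $\mathbb{R}$ and a nonempty finite set $\alpha\subset\mathbb{R}$, the distortion error is $V(P;\alpha)=\int\min_{a\in\alpha}|x-a|^2\,dP(x)$. The $n$th quantization error is $V_n(P)=\inf\{V(P;\alpha):\alpha\subset\mathbb{R},\ 1\le\mathrm{card}(\alpha)\le n\}$, and a set $\alpha$ with $1\le\mathrm{card}(\alpha)\le n$ attaining this infimum is called an optimal set of $n$-means for $P$. For integers $1\le k\le\ell$ put $Av[k,\ell]=\dfrac{\sum_{j=k}^{\ell}2^{-j}\frac1j}{\sum_{j=k}^{\ell}2^{-j}}$, $Av[k,\infty)=\dfrac{\sum_{j=k}^{\infty}2^{-j}\frac1j}{\sum_{j=k}^{\infty}2^{-j}}$, $Er[k,\ell]=\sum_{j=k}^{\ell}2^{-j}\big(\tfrac1j-Av[k,\ell]\big)^2$, $Er[k,\infty)=\sum_{j=k}^{\infty}2^{-j}\big(\tfrac1j-Av[k,\infty)\big)^2$. *)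

(* Defs.v *)
From HB Require Import structures.
From mathcomp Require Import all_boot all_order all_algebra finmap.
From mathcomp Require Import all_classical all_reals all_analysis.

Set Implicit Arguments.
Unset Strict Implicit.
Unset Printing Implicit Defensive.

Import Order.TTheory GRing.Theory Num.Theory.
Import numFieldNormedType.Exports.

Local Open Scope classical_set_scope.
Local Open Scope ring_scope.

Section Quantization.
Context {R : realType}.
Implicit Types (P : probability (measurableTypeR R) R) (alpha : {fset R}).

(* On a nonempty alpha the unit +oo of the minimum plays no role. *)
Definition distortion P alpha : \bar R :=
  (\int[P]_x \big[mine/+oo]_(a <- alpha) (`|x - a| ^+ 2)%:E)%E.

Definition quantizer (n : nat) : set {fset R} :=
  [set alpha | (1 <= #|` alpha| <= n)%N].

Definition quantization_error P (n : nat) : \bar R :=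
  ereal_inf (distortion P @` quantizer n).

Definition optimal_set_of_means P (n : nat) alpha : Prop :=
  quantizer n alpha /\ distortion P alpha = quantization_error P n.

End Quantization.

Section Averages.
Variable R : realType.

(* A meaningful value only for a convergent series; those used below converge. *)
Definition tail_sum (k : nat) (f : nat -> R) : R :=
  \big[+%R/0]_(k <= j <oo) f j.

Definition Av (k l : nat) : R :=
  (\sum_(k <= j < l.+1) 2^-1 ^+ j * j%:R^-1) / \sum_(k <= j < l.+1) 2^-1 ^+ j.

Definition Av_oo (k : nat) : R :=
  tail_sum k (fun j => 2^-1 ^+ j * j%:R^-1) / tail_sum k (fun j => 2^-1 ^+ j).

Definition Er (k l : nat) : R :=
  \sum_(k <= j < l.+1) 2^-1 ^+ j * (j%:R^-1 - Av k l) ^+ 2.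

Definition Er_oo (k : nat) : R :=
  tail_sum k (fun j => 2^-1 ^+ j * (j%:R^-1 - Av_oo k) ^+ 2).

Definition unit_fractions (m : nat) : {fset R} :=
  [fset j%:R^-1 | j in iota 1 m]%fset.

End Averages.

(* Main.v *)
From HB Require Import structures.
Require Import Defs.
From mathcomp Require Import all_boot all_order all_algebra finmap.
From mathcomp Require Import all_classical all_reals all_analysis.
From mathcomp Require Import measurable_realfun zify ring lra.

(* Write [x_j = 1/j].  Charge the distortion of [alpha] on the points [x_j],
   [j >= s], to [alpha] by peeling off the points one at a time: the cells are
   intervals, so either [x_s] and [x_(s+1)] share their nearest mean, or that
   mean can be dropped from [x_(s+1)] on.  By induction on the number of means,
   the problem becomes a comparison of the costs of the last few cells.  The
   infinite cells are controlled by
     [Er[k,oo) = Er[k+1,oo) + 2^-(k+1) (1/k - Av[k+1,oo))^2],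
   together with [1/(k+1) <= Av[k,oo)] (Jensen) and, for the comparison that
   switches between [n = 5] and [n = 6], an upper bound on [Av[k,oo)].
   Merging [x_s] and [x_(s+1)] costs at least [2^-s / (3 (s (s+1))^2)], too much
   unless [s] is within two steps of [n]. *)

Set Implicit Arguments.
Unset Strict Implicit.
Unset Printing Implicit Defensive.

Import Order.TTheory GRing.Theory Num.Theory.
Import numFieldNormedType.Exports.

Local Open Scope classical_set_scope.
Local Open Scope ring_scope.

(** * Series with weights [2^-j] and bounded coefficients *)

Section DyadicSums.
Variable R : realType.
Implicit Types (f g : nat -> R) (k : nat).

(** Against the weights [2^-j], boundedness gives absolute convergence, so that [tail_sum] is a
    genuine limit and not a default value. *)
Definition bounded_seq g := exists M, forall j, `|g j| <= M.

Definition dyadic_sum k g := tail_sum k (fun j => 2^-1 ^+ j * g j).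

Lemma expr_half_gt0 k : 0 < 2^-1 ^+ k :> R.
Proof. by rewrite exprn_gt0 // invr_gt0. Qed.

Lemma bounded_seqD f g :
  bounded_seq f -> bounded_seq g -> bounded_seq (fun j => f j + g j).
Proof.
move=> [M fM] [N gN]; exists (M + N) => j.
by rewrite (le_trans (ler_normD _ _)) ?lerD.
Qed.

Lemma bounded_seqZ c g : bounded_seq g -> bounded_seq (fun j => c * g j).
Proof.
by move=> [M gM]; exists (`|c| * M) => j; rewrite normrM ler_wpM2l.
Qed.

Lemma bounded_seqM f g :
  bounded_seq f -> bounded_seq g -> bounded_seq (fun j => f j * g j).
Proof.
by move=> [M fM] [N gN]; exists (M * N) => j; rewrite normrM ler_pM.
Qed.

Lemma bounded_seq_cst (c : R) : bounded_seq (fun=> c).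
Proof. by exists `|c|. Qed.

Lemma bounded_seq_inv : bounded_seq (fun j => j%:R^-1).
Proof.
exists 1 => -[|j]; first by rewrite invr0 normr0.
by rewrite ger0_norm // invf_le1 // ler1n.
Qed.

Lemma cvg_dyadic_sum k g : bounded_seq g ->
  (fun n => \sum_(k <= j < n) 2^-1 ^+ j * g j) @ \oo --> dyadic_sum k g.
Proof.
move=> [M gM]; suff : cvgn (fun n => \sum_(k <= j < n) 2^-1 ^+ j * g j) by [].
have cs : cvgn (series (fun j => 2^-1 ^+ j * g j)).
  apply: normed_cvg.
  apply: (@series_le_cvg _ _ (geometric M 2^-1)) => [n|n|n|] /=.
  - exact: normr_ge0.
  - rewrite mulr_ge0 ?exprn_ge0 ?invr_ge0 //.
    exact: le_trans (normr_ge0 _) (gM 0%N).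
  - by rewrite normrM gtr0_norm ?expr_half_gt0 // mulrC ler_wpM2r // ltW // expr_half_gt0.
  - by apply: is_cvg_geometric_series; rewrite ger0_norm; lra.
apply: cvgP; apply: cvg_trans (cvgB cs (cvg_cst (series _ k))).
by apply: near_eq_cvg; exists k => // n /= kn; rewrite -sub_series_geq.
Qed.

Arguments cvg_dyadic_sum k [g].

Lemma dyadic_sum_unique k g l : bounded_seq g ->
  (fun n => \sum_(k <= j < n) 2^-1 ^+ j * g j) @ \oo --> l -> dyadic_sum k g = l.
Proof. by move=> /(cvg_dyadic_sum k) gs gl; apply: (cvg_unique _ gs gl). Qed.

Lemma eq_dyadic_sum k f g : (forall j, (k <= j)%N -> f j = g j) ->
  dyadic_sum k f = dyadic_sum k g.
Proof.
move=> fg; congr (lim (_ @ \oo)); apply/funext => n.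
by apply: eq_big_nat => j /andP[kj _]; rewrite fg.
Qed.

Lemma dyadic_sum_recl k g : bounded_seq g ->
  dyadic_sum k g = 2^-1 ^+ k * g k + dyadic_sum k.+1 g.
Proof.
move=> bg; apply: dyadic_sum_unique => //.
apply: cvg_trans (cvgD (cvg_cst (2^-1 ^+ k * g k)) (cvg_dyadic_sum k.+1 bg)).
by apply: near_eq_cvg; exists k.+1 => // n /= kn; rewrite [RHS]big_ltn.
Qed.

Lemma dyadic_sumD k f g : bounded_seq f -> bounded_seq g ->
  dyadic_sum k (fun j => f j + g j) = dyadic_sum k f + dyadic_sum k g.
Proof.
move=> bf bg; apply: dyadic_sum_unique; first exact: bounded_seqD.
apply: cvg_trans (cvgD (cvg_dyadic_sum k bf) (cvg_dyadic_sum k bg)).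
apply: near_eq_cvg; exists 0%N => // n _ /=.
by under [RHS]eq_bigr do rewrite mulrDr; rewrite big_split.
Qed.

Lemma dyadic_sumZ k c g : bounded_seq g ->
  dyadic_sum k (fun j => c * g j) = c * dyadic_sum k g.
Proof.
move=> bg; apply: dyadic_sum_unique; first exact: bounded_seqZ.
apply: cvg_trans (cvgM (cvg_cst c) (cvg_dyadic_sum k bg)).
apply: near_eq_cvg; exists 0%N => // n _ /=.
by under [RHS]eq_bigr do rewrite mulrCA; rewrite -mulr_sumr.
Qed.

Lemma ler_dyadic_sum k f g : bounded_seq f -> bounded_seq g ->
  (forall j, (k <= j)%N -> f j <= g j) -> dyadic_sum k f <= dyadic_sum k g.
Proof.
move=> bf bg fg; apply: ler_lim.
- exact/cvgP/(cvg_dyadic_sum k bf).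
- exact/cvgP/(cvg_dyadic_sum k bg).
apply: nearW => n; apply: ler_sum_nat => j /andP[kj _].
by rewrite ler_wpM2l ?fg // ltW ?expr_half_gt0.
Qed.

Lemma dyadic_sum_cst k c : dyadic_sum k (fun=> c) = 2 * 2^-1 ^+ k * c.
Proof.
apply: dyadic_sum_unique; first exact: bounded_seq_cst.
suff : (fun n => 2 * 2^-1 ^+ k * c - 2 * c * 2^-1 ^+ n) @ \oo -->
       2 * 2^-1 ^+ k * c - 2 * c * 0.
  rewrite mulr0 subr0; apply: cvg_trans; apply: near_eq_cvg; exists k => // n /= kn.
  rewrite -(subnK kn); elim: (n - k)%N => [|m IH].
    by rewrite add0n big_geq //; ring.
  by rewrite addSn big_nat_recr ?leq_addl //= -IH exprS; field.
apply: cvgB; first exact: cvg_cst.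
apply: cvgM; first exact: cvg_cst.
by apply: cvg_expr; rewrite ger0_norm; lra.
Qed.

(** Supplies the boundedness that [halving_le0] asks for: a tail has mass [2 * 2^-k], so multiplying
    by [2^k] undoes its decay. *)
Lemma dyadic_sum_bounded g : bounded_seq g ->
  bounded_seq (fun k => 2 ^+ k * dyadic_sum k g).
Proof.
move=> bg; have [M gM] := bg; exists (2 * M) => k.
have e2 (c : R) : 2 * c = 2 ^+ k * dyadic_sum k (fun=> c).
  by rewrite dyadic_sum_cst exprVn; field; rewrite expf_neq0.
have M2 : - (2 * M) = 2 * - M by rewrite mulrN.
rewrite ler_norml M2 (e2 M) (e2 (- M)) !ler_pM2l ?exprn_gt0 //.
by apply/andP; split; apply: ler_dyadic_sum => //; try exact: bounded_seq_cst;
  move=> j _; have := gM j; rewrite ler_norml => /andP[].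
Qed.

(* Iterating the hypothesis gives [y k <= 2^-m * y (k + m)] for every [m]. *)
Lemma halving_le0 (y : nat -> R) k : bounded_seq y ->
  (forall j, (k <= j)%N -> y j <= y j.+1 / 2) -> y k <= 0.
Proof.
move=> [M yM] yS.
have it m : y k <= M * 2^-1 ^+ m.
  apply: (@le_trans _ _ (y (k + m)%N * 2^-1 ^+ m)); last first.
    by rewrite ler_pM2r ?expr_half_gt0 // (le_trans (ler_norm _)).
  elim: m => [|m IH]; first by rewrite addn0 expr0 mulr1.
  rewrite (le_trans IH) // exprS mulrA ler_pM2r ?expr_half_gt0 // addnS.
  exact/yS/leq_addr.
have M2 : (fun m => M * 2^-1 ^+ m) @ \oo --> M * 0.
  by apply: cvgM; [exact: cvg_cst|apply: cvg_expr; rewrite ger0_norm; lra].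
rewrite -(mulr0 M) -(cvg_lim _ M2) //; apply: limr_ge; first exact: cvgP M2.
exact: nearW.
Qed.

End DyadicSums.

Ltac pos_neq0 := repeat (apply/andP; split); rewrite gt_eqF //; lra.

(** * Means and errors of the infinite cells: recursions and explicit bounds *)

Section Tails.
Variable R : realType.
Implicit Types (k j : nat) (c : R).

Lemma bounded_seq_sqrB c : bounded_seq (fun j => (j%:R^-1 - c) ^+ 2).
Proof.
under eq_fun do rewrite expr2.
by apply: bounded_seqM; apply: bounded_seqD (bounded_seq_cst _);
  exact: bounded_seq_inv.
Qed.

Lemma Av_ooE k : Av_oo R k = 2 ^+ k * dyadic_sum k (fun j => j%:R^-1) / 2.
Proof.
rewrite /Av_oo; have -> : tail_sum k (fun j => 2^-1 ^+ j) = dyadic_sum k (fun=> 1 : R).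
  by congr (tail_sum _ _); apply/funext => j; rewrite mulr1.
by rewrite dyadic_sum_cst /dyadic_sum exprVn; field; rewrite expf_neq0.
Qed.

Lemma Av_oo_recl k : Av_oo R k = (k%:R^-1 + Av_oo R k.+1) / 2.
Proof.
rewrite !Av_ooE dyadic_sum_recl; last exact: bounded_seq_inv.
by rewrite exprVn exprS; move: k%:R^-1 => x; field; rewrite expf_neq0.
Qed.

(** Parallel axis theorem: the second moment about [c] is the one about the mean plus the mass times
    the squared displacement. The cross term vanishes because [A] is the mean. *)
Lemma dyadic_sum_sqrB k c : dyadic_sum k (fun j => (j%:R^-1 - c) ^+ 2) =
  Er_oo R k + 2 * 2^-1 ^+ k * (c - Av_oo R k) ^+ 2.
Proof.
set A := Av_oo R k.
have -> : (fun j => (j%:R^-1 - c) ^+ 2) = (fun j => (j%:R^-1 - A) ^+ 2 +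
    (2 * (A - c) * j%:R^-1 + (c ^+ 2 - A ^+ 2))).
  by apply/funext => j; ring.
have bi := @bounded_seq_inv R.
have bl := @bounded_seqZ _ (2 * (A - c)) _ bi.
have bc := @bounded_seq_cst _ (c ^+ 2 - A ^+ 2).
have bs := bounded_seq_sqrB A.
rewrite dyadic_sumD //; last exact: bounded_seqD.
rewrite dyadic_sumD // dyadic_sumZ // dyadic_sum_cst.
have -> : dyadic_sum k (fun j => j%:R^-1) = 2 * 2^-1 ^+ k * A.
  by rewrite /A Av_ooE exprVn; field; rewrite expf_neq0.
by rewrite /Er_oo -/A /dyadic_sum; ring.
Qed.

(** [Av[k,oo)] is the midpoint of [1/k] and [Av[k+1,oo)], and the point [1/k] has the same mass as
    the tail after it. Each of the two contributes half of the last term. *)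
Lemma Er_oo_recl k :
  Er_oo R k = Er_oo R k.+1 + 2^-1 ^+ k.+1 * (k%:R^-1 - Av_oo R k.+1) ^+ 2.
Proof.
rewrite {1}/Er_oo -/(dyadic_sum k (fun j => (j%:R^-1 - Av_oo R k) ^+ 2)).
rewrite dyadic_sum_recl; last exact: bounded_seq_sqrB.
rewrite dyadic_sum_sqrB (Av_oo_recl k) (exprS _ k).
by move: k%:R^-1 (2^-1 ^+ k) => x q; field.
Qed.

Lemma Er_oo_ge0 k : 0 <= Er_oo R k.
Proof.
rewrite -(mulr0 (2 * 2^-1 ^+ k)) -dyadic_sum_cst.
apply: ler_dyadic_sum => [||j _]; [exact: bounded_seq_cst|exact: bounded_seq_sqrB|].
exact: sqr_ge0.
Qed.

Lemma bounded_seq_Av_oo : bounded_seq (Av_oo R).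
Proof.
have -> : Av_oo R = fun k => 2^-1 * (2 ^+ k * dyadic_sum k (fun j => j%:R^-1)).
  by apply/funext => k; rewrite Av_ooE mulrC.
exact/bounded_seqZ/dyadic_sum_bounded/bounded_seq_inv.
Qed.

Lemma bounded_seq_Er_oo : bounded_seq (fun k => 2 ^+ k * Er_oo R k).
Proof.
have [M MP] := dyadic_sum_bounded (bounded_seq_sqrB 0); exists M => k.
apply: le_trans (MP k); rewrite dyadic_sum_sqrB.
have h := Er_oo_ge0 k; have e0 := expr_half_gt0 R k.
have t0 : 0 < 2 ^+ k :> R by rewrite exprn_gt0.
have s0 : 0 <= 2 * 2^-1 ^+ k * (0 - Av_oo R k) ^+ 2.
  by rewrite mulr_ge0 ?sqr_ge0 // mulr_ge0 // ltW.
rewrite ger0_norm; last by rewrite mulr_ge0 // ltW.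
rewrite ger0_norm; last by rewrite mulr_ge0 ?addr_ge0 // ltW.
by rewrite ler_pM2l // lerDl.
Qed.

(* Jensen's inequality: [k.+1] is the mean of [j] under the weights
   [2^-j], [j >= k]. *)
Lemma Av_oo_ge k : (0 < k)%N -> k.+1%:R^-1 <= Av_oo R k.
Proof.
move=> k0; rewrite -subr_le0.
(* By the recursion for [Av[j,oo)], a lower bound [v] only has to satisfy
   [v j <= (1/j + v (j+1)) / 2]. For [v j = 1/(j+1)] this is midpoint convexity of the inverse. *)
apply: (@halving_le0 _ (fun j => j.+1%:R^-1 - Av_oo R j)) => [|j kj].
  apply: bounded_seqD; last first.
    under eq_fun do rewrite -mulN1r.
    exact/bounded_seqZ/bounded_seq_Av_oo.
  have [M MP] := @bounded_seq_inv R; by exists M => j; exact: MP.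
have x1 : 1 <= j%:R :> R by rewrite ler1n (leq_trans k0).
rewrite (Av_oo_recl j) -(natr1 j.+1) -(natr1 j); move: (j%:R) x1 (Av_oo _ _) => x x1 A.
rewrite -subr_ge0.
have -> : ((x + 1 + 1)^-1 - A) / 2 - ((x + 1)^-1 - (x^-1 + A) / 2) =
    (x * (x + 1) * (x + 2))^-1 by field; pos_neq0.
by rewrite invr_ge0 !mulr_ge0; lra.
Qed.

Lemma Av_oo_le k : (0 < k)%N -> Av_oo R k <= k%:R^-1.
Proof.
move=> k0; rewrite -subr_le0.
apply: (@halving_le0 _ (fun j => Av_oo R j - j%:R^-1)) => [|j kj].
  apply: bounded_seqD; first exact: bounded_seq_Av_oo.
  under eq_fun do rewrite -mulN1r.
  exact/bounded_seqZ/bounded_seq_inv.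
have j0 : (0 < j)%N by rewrite (leq_trans k0).
have : j.+1%:R^-1 <= j%:R^-1 :> R by rewrite lef_pV2 ?posrE ?ltr0n // ler_nat.
by rewrite (Av_oo_recl j); move: (j.+1%:R^-1) (j%:R^-1) => u v; lra.
Qed.

Lemma Av_oo_gap k : (0 < k)%N ->
  0 <= k%:R^-1 - Av_oo R k.+1 <= 2 / (k%:R * (k%:R + 2)).
Proof.
move=> k0; have := Av_oo_ge (ltn0Sn k); have := Av_oo_le (ltn0Sn k).
have x1 : 1 <= k%:R :> R by rewrite ler1n.
have : k.+1%:R^-1 <= k%:R^-1 :> R by rewrite lef_pV2 ?posrE ?ltr0n // ler_nat.
rewrite -(natr1 k.+1) -(natr1 k); move: (k%:R) x1 => x x1.
have -> : 2 / (x * (x + 2)) = x^-1 - (x + 1 + 1)^-1 by field; pos_neq0.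
move=> h1 h2 h3; apply/andP; split; lra.
Qed.

Lemma Av_oo_gap_sqr k : (0 < k)%N ->
  (k%:R^-1 - Av_oo R k.+1) ^+ 2 <= 4 / (k%:R * (k%:R + 2)) ^+ 2.
Proof.
move=> /Av_oo_gap/andP[g0 g1].
have -> : 4 / (k%:R * (k%:R + 2)) ^+ 2 = (2 / (k%:R * (k%:R + 2))) ^+ 2 :> R.
  by move: (_ * (_ + 2)) => y; rewrite exprMn exprVn; congr (_ * _); ring.
by rewrite ler_pXn2r // nnegrE (le_trans g0).
Qed.

(** Put [E k = 2^k Er[k,oo)], [g k = 1/k - Av[k+1,oo)] and let [a k] be the claimed bound on [E k].
    Then [E k = (E (k+1) + (g k)^2) / 2], while [(g k)^2 <= a k] and [a] decreases, so [E - a] is at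
    most half its next value. *)
Lemma Er_oo_le k : (0 < k)%N ->
  Er_oo R k <= 2^-1 ^+ k * (4 / (k%:R * (k%:R + 2)) ^+ 2).
Proof.
move=> k0; have t0 : 0 < 2 ^+ k :> R by rewrite exprn_gt0.
rewrite exprVn ler_pdivlMl // -subr_le0.
apply: (@halving_le0 _ (fun j =>
    2 ^+ j * Er_oo R j - 4 / (j%:R * (j%:R + 2)) ^+ 2)) => [|j kj].
  apply: bounded_seqD; first exact: bounded_seq_Er_oo.
  exists 4 => -[|j]; first by rewrite mul0r expr0n /= invr0 mulr0 oppr0 normr0.
  rewrite normrN ger0_norm ?divr_ge0 ?sqr_ge0 // ler_pdivrMr; last first.
    by rewrite exprn_gt0 // -natrD -natrM ltr0n.
  by rewrite ler_pMr // exprn_ege1 // -natrD -natrM ler1n.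
have j0 : (0 < j)%N by rewrite (leq_trans k0).
rewrite (Er_oo_recl j) exprVn.
have -> : 2 ^+ j * (Er_oo R j.+1 + (2 ^+ j.+1)^-1 * (j%:R^-1 - Av_oo R j.+1) ^+ 2)
    = 2 ^+ j.+1 * Er_oo R j.+1 / 2 + (j%:R^-1 - Av_oo R j.+1) ^+ 2 / 2.
  by rewrite exprS; move: (j%:R^-1) => x; field; rewrite expf_neq0.
have arith (E g a b : R) : g <= a -> b <= a -> E / 2 + g / 2 - a <= (E - b) / 2 by lra.
apply: arith; first exact: Av_oo_gap_sqr.
have x1 : 1 <= j%:R :> R by rewrite ler1n.
rewrite -(natr1 j); move: (j%:R) x1 => x x1.
have a0 : 0 < x * (x + 2) by apply: mulr_gt0; lra.
have ab : x * (x + 2) <= (x + 1) * (x + 1 + 2) by nra.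
have b0 := lt_le_trans a0 ab.
by rewrite ler_pM2l // lef_pV2 ?posrE ?exprn_gt0 // ler_pXn2r // nnegrE ltW.
Qed.

Lemma bounded_seq_invB n : bounded_seq (fun j => (j%:R - n%:R : R)^-1).
Proof.
exists 1 => j; have [M1|] := leqP j n; last move=> /ltnW M1.
  rewrite -opprB -natrB // invrN normrN.
  by case: (n - j)%N => [|m]; rewrite ?invr0 ?normr0 // ger0_norm // invf_le1 // ler1n.
rewrite -natrB //.
by case: (j - n)%N => [|m]; rewrite ?invr0 ?normr0 // ger0_norm // invf_le1 // ler1n.
Qed.

(** The bound [v] is shaped so that at [k+1] it becomes [1/k - c / (k (k-1))] with [c = 37/32]. The
    defect in its recursion has numerator [(2 - c) j - 4 - 2 c], which is nonnegative from [j = 8]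
    on. *)
Lemma Av_oo_upper k : (8 <= k)%N ->
  Av_oo R k <= (k%:R - 1)^-1 - 37 / 32 / ((k%:R - 1) * (k%:R - 2)).
Proof.
move=> k8; rewrite -subr_le0.
set v := fun j : nat => (j%:R - 1)^-1 - 37 / 32 / ((j%:R - 1) * (j%:R - 2)) : R.
apply: (@halving_le0 _ (fun j => Av_oo R j - v j)) => [|j kj].
  apply: bounded_seqD; first exact: bounded_seq_Av_oo.
  have -> : (fun j => - v j) = (fun j => (j%:R - 1)^-1 *
      (37 / 32 * (j%:R - 2)^-1 + -1)).
    by apply/funext => j; rewrite /v invfM; ring.
  apply: bounded_seqM; first exact: (bounded_seq_invB 1).
  exact: bounded_seqD (bounded_seqZ _ (bounded_seq_invB 2)) (bounded_seq_cst _).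
have x8 : 8 <= j%:R :> R by rewrite (ler_nat _ 8) (leq_trans k8).
rewrite (Av_oo_recl j) /v -(natr1 j); move: (j%:R) x8 (Av_oo _ _) => x x8 A.
rewrite -subr_ge0.
have -> : (A - ((x + 1 - 1)^-1 - 37 / 32 / ((x + 1 - 1) * (x + 1 - 2)))) / 2
   - ((x^-1 + A) / 2 - ((x - 1)^-1 - 37 / 32 / ((x - 1) * (x - 2)))) =
   ((2 - 37 / 32) * x - 4 - 2 * (37 / 32)) / (2 * x * (x-1) * (x-2)).
  by field; pos_neq0.
by apply: divr_ge0; [lra|rewrite !mulr_ge0; lra].
Qed.

(* The constant must exceed [2 / sqrt 3 = 1.1547], and for [k = 6] the largest
   admissible one is 1.1574: for [k = 5] the comparison goes the other way. *)
Lemma Av_oo_gap_ge k : (6 <= k)%N ->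
  37 / 32 / (k%:R * (k%:R - 1)) <= k%:R^-1 - Av_oo R k.+1.
Proof.
rewrite leq_eqVlt => /predU1P[<-|k7].
  (* [Av_oo_upper] starts at 8, so [Av[7,oo)] is unrolled eight times, down to
     [Av[15,oo) <= 1/15]. *)
  have := @Av_oo_le 15 isT.
  rewrite (Av_oo_recl 7) (Av_oo_recl 8) (Av_oo_recl 9) (Av_oo_recl 10).
  rewrite (Av_oo_recl 11) (Av_oo_recl 12) (Av_oo_recl 13) (Av_oo_recl 14).
  have -> : 6 * (6 - 1) = 30 :> R by ring.
  lra.
have := @Av_oo_upper k.+1 k7; rewrite -(natr1 k).
have -> : k%:R + 1 - 1 = k%:R :> R by ring.
have -> : k%:R + 1 - 2 = k%:R - 1 :> R by ring.
lra.
Qed.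

End Tails.

(** * Costs of finite cells as combinations of products of inverse squares *)

Section InverseSquares.
Variable R : realType.
Implicit Types (i j k : nat).

(** Since [(1/k - 1/(k+d))^2 = d^2 * invsq k * invsq (k+d)], all costs become linear in such
    products, and comparing them becomes linear arithmetic. *)
Definition invsq k : R := k%:R^-1 ^+ 2.

Lemma invsq_gt0 k : (0 < k)%N -> 0 < invsq k.
Proof. by move=> k0; rewrite exprn_gt0 // invr_gt0 ltr0n. Qed.

Lemma invsq_le i j : (0 < i <= j)%N -> invsq j <= invsq i.
Proof.
move=> /andP[i0 ij]; have j0 := leq_trans i0 ij.
by rewrite ler_pXn2r ?nnegrE ?invr_ge0 // lef_pV2 ?posrE ?ltr0n // ler_nat.
Qed.

Lemma invsqM_le i j k l : (0 < i <= j)%N -> (0 < k <= l)%N ->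
  invsq j * invsq l <= invsq i * invsq k.
Proof. by move=> ij kl; rewrite ler_pM ?sqr_ge0 ?invsq_le. Qed.

(** Turns a lower bound [i] on the index into a linear inequality between neighbouring inverse
    squares: [(k+1)/k] is at most [(i+1)/i]. *)
Lemma invsq_ratio i k : (0 < i <= k)%N ->
  i%:R ^+ 2 * invsq k <= i.+1%:R ^+ 2 * invsq k.+1.
Proof.
move=> /andP[i0 ik]; have k0 := leq_trans i0 ik.
rewrite /invsq -!exprMn ler_pXn2r ?nnegrE ?mulr_ge0 ?invr_ge0 //.
rewrite ler_pdivrMr ?ltr0n // mulrAC ler_pdivlMr ?ltr0n // -!natrM ler_nat.
by rewrite mulnS mulSn leq_add2r.
Qed.

Lemma sqr_invB k d : (0 < k)%N ->
  (k%:R^-1 - (k + d)%:R^-1) ^+ 2 = d%:R ^+ 2 * (invsq k * invsq (k + d)) :> R.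
Proof.
move=> k0; have kd : 0 < (k + d)%:R :> R by rewrite ltr0n addn_gt0 k0.
have k' : 0 < k%:R :> R by rewrite ltr0n.
rewrite /invsq -!exprMn; congr (_ ^+ 2); rewrite natrD in kd *.
by field; rewrite !gt_eqF.
Qed.

Lemma invsqM2E k : 4 / (k%:R * (k%:R + 2)) ^+ 2 = 4 * (invsq k * invsq k.+2).
Proof.
by rewrite /invsq -(addn2 k) natrD exprMn invfM !exprVn.
Qed.

Lemma Er_oo_le_invsq k : (0 < k)%N ->
  Er_oo R k <= 2^-1 ^+ k * (4 * (invsq k * invsq k.+2)).
Proof.
move=> k0; apply: (le_trans (Er_oo_le R k0)).
by rewrite invsqM2E.
Qed.

(** Only one step of the recursion is estimated. [Er[k+1,oo)] is kept, to cancel or be dominated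
    when the other side of a comparison contains it or more. *)
Lemma Er_oo_le_next k : (0 < k)%N ->
  Er_oo R k <= Er_oo R k.+1 + 2^-1 ^+ k * (2 * (invsq k * invsq k.+2)).
Proof.
move=> k0; rewrite {1}Er_oo_recl lerD2l.
have := Av_oo_gap_sqr R k0; rewrite invsqM2E.
move: (_ - _) (invsq _ * _) (expr_half_gt0 R k) => g p q0 gp.
by rewrite exprS -mulrA mulrCA ler_pM2l //; lra.
Qed.

Lemma Av_pairE k : Av R k k.+1 = (2 * k%:R^-1 + k.+1%:R^-1) / 3.
Proof.
rewrite /Av 2?big_nat_recl // 2?big_nat_recl // !big_geq // !addr0.
rewrite exprS; move: (k%:R^-1) (k.+1%:R^-1) (expr_half_gt0 R k) => x y q0.
by field; rewrite gt_eqF.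
Qed.

Lemma pair_cost k a :
  2^-1 ^+ k * (k%:R^-1 - a) ^+ 2 + 2^-1 ^+ k.+1 * (k.+1%:R^-1 - a) ^+ 2 =
  Er R k k.+1 + 3 / 2 * 2^-1 ^+ k * (a - Av R k k.+1) ^+ 2.
Proof.
rewrite /Er Av_pairE 2?big_nat_recl // big_geq // addr0 (exprS _ k).
by move: (k%:R^-1) (k.+1%:R^-1) (2^-1 ^+ k) => x y q; field.
Qed.

Lemma Er_pairE k : (0 < k)%N ->
  Er R k k.+1 = 2^-1 ^+ k * (3^-1 * (invsq k * invsq k.+1)).
Proof.
move=> k0; have := sqr_invB 1 k0; rewrite expr1n mul1r addn1 => <-.
rewrite /Er Av_pairE 2?big_nat_recl // big_geq // addr0 (exprS _ k).
by move: (k%:R^-1) (k.+1%:R^-1) (2^-1 ^+ k) => x y q; field.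
Qed.

Lemma pair_cost_ge k a :
  Er R k k.+1 <=
  2^-1 ^+ k * (k%:R^-1 - a) ^+ 2 + 2^-1 ^+ k.+1 * (k.+1%:R^-1 - a) ^+ 2.
Proof.
by rewrite pair_cost lerDl mulr_ge0 ?sqr_ge0 // mulr_ge0 ?ltW ?expr_half_gt0 ?divr_gt0.
Qed.

(* Weights [w_i] at points [x_i] have second moment about any [a] at least
   [(\sum_(i < j) w_i * w_j * (x_i - x_j) ^+ 2) / \sum_i w_i]. *)
Lemma triple_cost_ge k a : (0 < k)%N ->
  2^-1 ^+ k * (2 / 7 * (invsq k * invsq k.+1) + 4 / 7 * (invsq k * invsq k.+2)
    + 1 / 14 * (invsq k.+1 * invsq k.+2)) <=
  2^-1 ^+ k * (k%:R^-1 - a) ^+ 2 + 2^-1 ^+ k.+1 * (k.+1%:R^-1 - a) ^+ 2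
    + 2^-1 ^+ k.+2 * (k.+2%:R^-1 - a) ^+ 2.
Proof.
move=> k0.
have := sqr_invB 1 k0; have := sqr_invB 2 k0; have := sqr_invB 1 (ltn0Sn k).
rewrite !expr1n !mul1r !addn1 !addn2 => <- d2 <-.
have -> : 4 / 7 * (invsq k * invsq k.+2) =
    1 / 7 * (k%:R^-1 - k.+2%:R^-1) ^+ 2 by rewrite d2; ring.
rewrite (exprS _ k.+1) (exprS _ k).
move: (k%:R^-1) (k.+1%:R^-1) (k.+2%:R^-1) (expr_half_gt0 R k) => x y z q0.
rewrite -subr_ge0.
set D := (X in 0 <= X).
have -> : D = 2^-1 ^+ k * (7 / 4 * (a - (4 * x + 2 * y + z) / 7) ^+ 2).
  by rewrite /D; field.
apply: mulr_ge0; first exact: ltW.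
by apply: mulr_ge0; [lra|exact: sqr_ge0].
Qed.

Lemma quadruple_cost_ge k a : (0 < k)%N ->
  2^-1 ^+ k * (8 / 15 * (1 / 2 * (invsq k * invsq k.+1) + invsq k * invsq k.+2
    + 9 / 8 * (invsq k * invsq k.+3) + 1 / 8 * (invsq k.+1 * invsq k.+2)
    + 1 / 4 * (invsq k.+1 * invsq k.+3))) <=
  2^-1 ^+ k * (k%:R^-1 - a) ^+ 2 + 2^-1 ^+ k.+1 * (k.+1%:R^-1 - a) ^+ 2
    + 2^-1 ^+ k.+2 * (k.+2%:R^-1 - a) ^+ 2 + 2^-1 ^+ k.+3 * (k.+3%:R^-1 - a) ^+ 2.
Proof.
move=> k0.
have := sqr_invB 1 k0; have := sqr_invB 2 k0; have := sqr_invB 3 k0.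
have := sqr_invB 1 (ltn0Sn k); have := sqr_invB 2 (ltn0Sn k).
rewrite !expr1n !mul1r !addn1 !addn2 !addn3 => d13 <- d03 d02 <-.
have -> : 9 / 8 * (invsq k * invsq k.+3) =
    1 / 8 * (k%:R^-1 - k.+3%:R^-1) ^+ 2 by rewrite d03; field.
have -> : 4^-1 * (invsq k.+1 * invsq k.+3) =
    1 / 16 * (k.+1%:R^-1 - k.+3%:R^-1) ^+ 2 by rewrite d13; field.
have -> : invsq k * invsq k.+2 =
    1 / 4 * (k%:R^-1 - k.+2%:R^-1) ^+ 2 by rewrite d02; field.
rewrite (exprS _ k.+2) (exprS _ k.+1) (exprS _ k).
move: (k%:R^-1) (k.+1%:R^-1) (k.+2%:R^-1) (k.+3%:R^-1) (expr_half_gt0 R k) => x y z t q0.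
rewrite -subr_ge0.
set D := (X in 0 <= X).
(* The excess is the displacement of [a] from the weighted mean plus the pair of the last two
   points, which the stated bound leaves out. *)
have -> : D = 2^-1 ^+ k * (15 / 8 * (a - (8 * x + 4 * y + 2 * z + t) / 15) ^+ 2
    + 1 / 60 * (z - t) ^+ 2).
  by rewrite /D; field.
apply: mulr_ge0; first exact: ltW.
by apply: addr_ge0; apply: mulr_ge0; rewrite ?sqr_ge0 //; lra.
Qed.

End InverseSquares.

(** * Strict inequalities between competing last cells *)

Section CostComparison.
Variable R : realType.
Implicit Types (s : nat) (a : R).

Local Notation p := (invsq R).
Local Notation w k := (2^-1 ^+ k : R).

Lemma expr_half1 s : w s.+1 = w s / 2.
Proof. by rewrite !exprS; field. Qed.

Lemma expr_half2 s : w s.+2 = w s / 4.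
Proof. by rewrite !exprS; field. Qed.

Lemma expr_half3 s : w s.+3 = w s / 8.
Proof. by rewrite !exprS; field. Qed.

Lemma invsqM_gt0 i j : (0 < i)%N -> (0 < j)%N -> 0 < p i * p j.
Proof. by move=> i0 j0; rewrite mulr_gt0 ?invsq_gt0. Qed.

(** The switch between the two regimes: it pays to pair [1/s] with [1/(s+1)] instead of giving [1/s]
    its own mean. After cancelling [Er[s+2,oo)], the gap [g] must satisfy
    [g^2 > 4/3 * invsq s * invsq (s+1)], and [(37/32)^2 = 1369/1024] exceeds [4/3]. *)
Lemma pair_tail_lt_tail s : (5 <= s)%N ->
  Er_oo R s.+2 + Er R s s.+1 < Er_oo R s.+1.
Proof.
move=> s5; have s0 : (0 < s)%N by lia.
rewrite (Er_oo_recl R s.+1) ltrD2l Er_pairE // expr_half2.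
have := @Av_oo_gap_ge R s.+1 s5; set g := (X in _ <= X).
have -> : s.+1%:R - 1 = s%:R :> R by rewrite -natr1 addrK.
rewrite invfM => gP.
have g0 : 0 <= s.+1%:R^-1 * s%:R^-1 :> R by rewrite mulr_ge0 ?invr_ge0.
have hg : 1369 / 1024 * (p s * p s.+1) <= g ^+ 2.
  have -> : 1369 / 1024 * (p s * p s.+1) = (37 / 32 * (s.+1%:R^-1 * s%:R^-1)) ^+ 2.
    by rewrite /invsq; move: (s%:R^-1) (s.+1%:R^-1) => x y; field.
  have c0 : 0 <= 37 / 32 * (s.+1%:R^-1 * s%:R^-1) :> R by apply: mulr_ge0 => //; lra.
  by rewrite ler_pXn2r // nnegrE // (le_trans c0).
have P0 := invsqM_gt0 s0 (ltn0Sn s).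
have := expr_half_gt0 R s; move: (2^-1 ^+ s) => q q0.
have h : 3^-1 * (p s * p s.+1) < 4^-1 * g ^+ 2 by lra.
rewrite -(ltr_pM2l q0) in h; rewrite -/g; lra.
Qed.

Lemma pair_tail_lt_triple s a : (5 <= s)%N ->
  Er_oo R s.+2 + Er R s s.+1 <
  w s * (s%:R^-1 - a) ^+ 2 + w s.+1 * (s.+1%:R^-1 - a) ^+ 2
    + w s.+2 * (s.+2%:R^-1 - a) ^+ 2 + Er_oo R s.+3.
Proof.
move=> s5; have s0 : (0 < s)%N by lia.
apply: lt_le_trans (lerD (@triple_cost_ge R s a s0) (lexx _)).
have := @Er_oo_le_next R s.+2 isT.
rewrite Er_pairE // expr_half2.
have := expr_half_gt0 R s; move: (2^-1 ^+ s) => q q0.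
have P01 := invsqM_gt0 s0 (ltn0Sn s).
have P24 : p s.+2 * p s.+4 <= p s * p s.+2 by rewrite [leRHS]mulrC invsqM_le //; lia.
(* The ratios of neighbouring inverse squares are largest at [s = 5], where they are [49/36] and
   [36/25]. *)
have P02 : 36 * (p s * p s.+1) <= 49 * (p s * p s.+2).
  have := @invsq_ratio R 6 s.+1 s5; have := invsq_gt0 R s0.
  by rewrite -!natrX; nra.
have P12 : 25 * (p s * p s.+2) <= 36 * (p s.+1 * p s.+2).
  have := @invsq_ratio R 5 s s5; have := @invsq_gt0 R s.+2 isT.
  by rewrite -!natrX; nra.
have h : 3^-1 * (p s * p s.+1) + 1/2 * (p s.+2 * p s.+4) <
  2 / 7 * (p s * p s.+1) + 4 / 7 * (p s * p s.+2) + 1 / 14 * (p s.+1 * p s.+2) by lra.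
rewrite -(ltr_pM2l q0) in h; lra.
Qed.

(** Four points sharing a mean already cost too much, so nothing has to be known of the later
    points. *)
Lemma pair_tail_lt_quadruple s a : (5 <= s)%N ->
  Er_oo R s.+2 + Er R s s.+1 <
  w s * (s%:R^-1 - a) ^+ 2 + w s.+1 * (s.+1%:R^-1 - a) ^+ 2
    + w s.+2 * (s.+2%:R^-1 - a) ^+ 2 + w s.+3 * (s.+3%:R^-1 - a) ^+ 2.
Proof.
move=> s5; have s0 : (0 < s)%N by lia.
apply: lt_le_trans (@quadruple_cost_ge R s a s0).
have := @Er_oo_le_invsq R s.+2 isT.
rewrite Er_pairE // expr_half2.
have := expr_half_gt0 R s; move: (2^-1 ^+ s) => q q0.
have P01 := invsqM_gt0 s0 (ltn0Sn s).
have P24a : p s.+2 * p s.+4 <= p s * p s.+2 by rewrite [leRHS]mulrC invsqM_le //; lia.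
have P24b : p s.+2 * p s.+4 <= p s * p s.+3 by rewrite invsqM_le //; lia.
have r1 : 25 * p s <= 36 * p s.+1.
  by have := @invsq_ratio R 5 s s5; rewrite -!natrX.
have r2 : 36 * p s.+1 <= 49 * p s.+2.
  by have := @invsq_ratio R 6 s.+1 s5; rewrite -!natrX.
have r3 : 49 * p s.+2 <= 64 * p s.+3.
  by have := @invsq_ratio R 7 s.+2 s5; rewrite -!natrX.
have p0 := invsq_gt0 R s0.
have P03 : 36 * (p s * p s.+1) <= 64 * (p s * p s.+3) by nra.
have P12 : 0 < p s.+1 * p s.+2 by exact: invsqM_gt0.
have P13 : 0 < p s.+1 * p s.+3 by exact: invsqM_gt0.
have h : 3^-1 * (p s * p s.+1) + p s.+2 * p s.+4 <
  8 / 15 * (1 / 2 * (p s * p s.+1) + p s * p s.+2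
    + 9 / 8 * (p s * p s.+3) + 1 / 8 * (p s.+1 * p s.+2)
    + 1 / 4 * (p s.+1 * p s.+3)) by lra.
rewrite -(ltr_pM2l q0) in h; lra.
Qed.

Lemma pair_tail_lt_pair s a : (4 <= s)%N ->
  Er_oo R s.+3 + Er R s.+1 s.+2 <
  w s * (s%:R^-1 - a) ^+ 2 + w s.+1 * (s.+1%:R^-1 - a) ^+ 2
    + (Er_oo R s.+4 + Er R s.+2 s.+3).
Proof.
move=> s4; have s0 : (0 < s)%N by lia.
apply: lt_le_trans (lerD (@pair_cost_ge R s a) (lexx _)).
have := @Er_oo_le_next R s.+3 isT.
rewrite !Er_pairE // expr_half3 expr_half2 expr_half1.
have := expr_half_gt0 R s; move: (2^-1 ^+ s) => q q0.
have P35 := invsqM_gt0 (ltn0Sn s.+2) (ltn0Sn s.+4).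
have P1 : p s.+1 * p s.+2 < p s * p s.+1.
  rewrite mulrC ltr_pM2r ?invsq_gt0 // /invsq ltr_pXn2r ?nnegrE ?invr_ge0 //.
  by rewrite ltf_pV2 ?posrE ?ltr0n // ltr_nat; lia.
have P2 : p s.+3 * p s.+4.+1 <= p s.+2 * p s.+3.
  by rewrite [leRHS]mulrC invsqM_le //; lia.
have P3 : p s.+2 * p s.+3 <= p s.+1 * p s.+2.
  by rewrite invsqM_le //; lia.
have h : 1 / 6 * (p s.+1 * p s.+2) + 1 / 4 * (p s.+3 * p s.+4.+1) <
   3^-1 * (p s * p s.+1) + 1 / 12 * (p s.+2 * p s.+3) by lra.
rewrite -(ltr_pM2l q0) in h; lra.
Qed.

Lemma pair_tail_lt_initial_triple s a : (4 <= s)%N ->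
  Er_oo R s.+3 + Er R s.+1 s.+2 <
  w s * (s%:R^-1 - a) ^+ 2 + w s.+1 * (s.+1%:R^-1 - a) ^+ 2
    + w s.+2 * (s.+2%:R^-1 - a) ^+ 2.
Proof.
move=> s4; have s0 : (0 < s)%N by lia.
apply: lt_le_trans (@triple_cost_ge R s a s0).
have := @Er_oo_le_invsq R s.+3 isT.
rewrite !Er_pairE // expr_half3 expr_half1.
have := expr_half_gt0 R s; move: (2^-1 ^+ s) => q q0.
have P01 := invsqM_gt0 s0 (ltn0Sn s).
have P1 : p s.+3 * p s.+4.+1 <= p s * p s.+2 by rewrite invsqM_le //; lia.
have P2 : p s.+1 * p s.+2 <= p s * p s.+1 by rewrite invsqM_le //; lia.
have P3 : p s.+1 * p s.+2 <= p s * p s.+2 by rewrite invsqM_le //; lia.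
have P12 : 0 < p s.+1 * p s.+2 by exact: invsqM_gt0.
have h : 1 / 6 * (p s.+1 * p s.+2) + 1 / 2 * (p s.+3 * p s.+4.+1) <
   2 / 7 * (p s * p s.+1) + 4 / 7 * (p s * p s.+2) + 1 / 14 * (p s.+1 * p s.+2) by lra.
rewrite -(ltr_pM2l q0) in h; lra.
Qed.

(** The left side is at most [4/3 * 2^-r * invsq r * invsq (r+1)], and [2^-r <= 2^-s / 4] absorbs
    the 4. Strictness comes from the decrease of [invsq]. *)
Lemma pair_tail_lt_initial_pair s r : (0 < s)%N -> (s.+2 <= r)%N ->
  Er_oo R r.+2 + Er R r r.+1 < Er R s s.+1.
Proof.
move=> s0 sr; have r0 : (0 < r)%N by lia.
have := @Er_oo_le_invsq R r.+2 isT.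
rewrite !Er_pairE // expr_half2 => hE.
have P1 : p r.+2 * p r.+4 <= p r * p r.+1 by rewrite invsqM_le //; lia.
have P2 : p r * p r.+1 <= p s.+2 * p s.+3 by rewrite invsqM_le //; lia.
have P3 : p s.+2 * p s.+3 < p s * p s.+1.
  apply: (@le_lt_trans _ _ (p s * p s.+3)); first by rewrite invsqM_le //; lia.
  rewrite ltr_pM2l ?invsq_gt0 // /invsq ltr_pXn2r ?nnegrE ?invr_ge0 //.
  by rewrite ltf_pV2 ?posrE ?ltr0n // ltr_nat; lia.
have Pr := invsqM_gt0 r0 (ltn0Sn r).
have q0 := expr_half_gt0 R s; have qr := expr_half_gt0 R r.
have qsr : w r <= w s / 4.
  by rewrite -expr_half2 ler_wiXn2l // ?invr_ge0 ?invf_le1 // ler1n.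
have h1 : w r * (p r * p r.+1) <= w s / 4 * (p r * p r.+1) by rewrite ler_pM2r.
have h2 : w s * (p r * p r.+1) < w s * (p s * p s.+1) by rewrite ltr_pM2l; lra.
have h3 : w r * (p r.+2 * p r.+4) <= w r * (p r * p r.+1) by rewrite ler_pM2l.
lra.
Qed.

Lemma tail_lt_pair s a : (0 < s <= 4)%N ->
  Er_oo R s.+1 <
  w s * (s%:R^-1 - a) ^+ 2 + w s.+1 * (s.+1%:R^-1 - a) ^+ 2 + Er_oo R s.+2.
Proof.
move=> /andP[s0 s4].
apply: lt_le_trans (lerD (@pair_cost_ge R s a) (lexx _)).
have := @Er_oo_le_next R s.+1 isT.
rewrite !Er_pairE // expr_half1.
have := expr_half_gt0 R s; move: (2^-1 ^+ s) => q q0.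
(* This amounts to [3 s^2 < (s+3)^2], which for positive integers holds exactly when [s <= 4]. *)
have h : p s.+1 * p s.+3 < 3^-1 * (p s * p s.+1).
  by move: s0 s4; rewrite /invsq; case: s => [|[|[|[|[|s]]]]] // _ _; lra.
rewrite -(ltr_pM2l q0) in h; lra.
Qed.

Lemma tail_lt_triple s a : (0 < s <= 4)%N ->
  Er_oo R s.+1 <
  w s * (s%:R^-1 - a) ^+ 2 + w s.+1 * (s.+1%:R^-1 - a) ^+ 2
    + w s.+2 * (s.+2%:R^-1 - a) ^+ 2.
Proof.
move=> /andP[s0 s4].
apply: lt_le_trans (@triple_cost_ge R s a s0).
have := @Er_oo_le_invsq R s.+1 isT.
rewrite expr_half1.
have := expr_half_gt0 R s; move: (2^-1 ^+ s) => q q0.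
have h : 2 * (p s.+1 * p s.+3) < 2 / 7 * (p s * p s.+1)
    + 4 / 7 * (p s * p s.+2) + 1 / 14 * (p s.+1 * p s.+2).
  by move: s0 s4; rewrite /invsq; case: s => [|[|[|[|[|s]]]]] // _ _; lra.
rewrite -(ltr_pM2l q0) in h; lra.
Qed.

Lemma tail_lt_initial_pair s r : (0 < s)%N -> (s.+2 <= r <= 5)%N ->
  Er_oo R r < Er R s s.+1.
Proof.
move=> s0 /andP[sr r5]; have r0 : (0 < r)%N by lia.
have := @Er_oo_le_invsq R r r0.
rewrite !Er_pairE // => hE.
have P2 : p r * p r.+2 <= p s.+2 * p s.+4 by rewrite invsqM_le //; lia.
have P3 : 3 * (p s.+2 * p s.+4) < p s * p s.+1.
  have : (s <= 3)%N by lia.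
  by move: s0; rewrite /invsq; case: s {sr P2} => [|[|[|[|s]]]] // _ _; lra.
have Pr := invsqM_gt0 r0 (ltn0Sn r.+1).
have q0 := expr_half_gt0 R s.
have qsr : w r <= w s / 4.
  by rewrite -expr_half2 ler_wiXn2l // ?invr_ge0 ?invf_le1 // ler1n.
have h1 : w r * (p r * p r.+2) <= w s / 4 * (p r * p r.+2) by rewrite ler_pM2r.
have h2 : w s * (3 * (p r * p r.+2)) < w s * (p s * p s.+1) by rewrite ltr_pM2l; lra.
lra.
Qed.

End CostComparison.

(** * Distortion on the points [1/j], [j >= s], and the peeling of points *)

Section TailDistortion.
Variable R : realType.
Implicit Types (x a b : R) (alpha beta : {fset R}) (s j k : nat).

Local Notation min_sqdist alpha x :=
  (\big[mine/+oo]_(a <- alpha) (`|x - a| ^+ 2)%:E)%E.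

(** On a nonempty [alpha] the minimum is finite and [fine] loses nothing; on the empty set it turns
    [+oo] into 0. *)
Definition sqdist alpha x : R := fine (min_sqdist alpha x).

Lemma min_sqdist_attained (r : seq R) x : r != [::] ->
  (exists2 a, a \in r & (min_sqdist r x = ((x - a) ^+ 2)%:E)%E) /\
  (forall a, a \in r -> (min_sqdist r x <= ((x - a) ^+ 2)%:E)%E).
Proof.
elim: r => // a r IH _; have [->|/IH {IH}[[b br bE] bmin]] := eqVneq r [::].
  rewrite big_seq1 -normrX ger0_norm ?sqr_ge0 //; split; first by exists a; rewrite ?inE.
  by move=> b; rewrite inE => /eqP ->.
rewrite big_cons -normrX ger0_norm ?sqr_ge0 //; split.
  have [_|_] := leP (((x - a) ^+ 2)%:E)%E (min_sqdist r x).
    by exists a => //; rewrite inE eqxx.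
  by exists b => //; rewrite inE br orbT.
move=> c; rewrite inE => /predU1P[->|/bmin cr]; first by rewrite ge_min lexx.
by rewrite ge_min cr orbT.
Qed.

Lemma fset_seq_neq0 alpha : (0 < #|` alpha|)%N -> (alpha : seq R) != [::].
Proof. by rewrite lt0n size_eq0. Qed.

Lemma min_sqdistE alpha x : (0 < #|` alpha|)%N ->
  (min_sqdist alpha x = (sqdist alpha x)%:E)%E.
Proof.
move=> /fset_seq_neq0 a0; rewrite /sqdist.
by have [[a _ ->] _] := min_sqdist_attained x a0.
Qed.

Lemma sqdist_attained alpha x : (0 < #|` alpha|)%N ->
  exists2 a, a \in alpha & sqdist alpha x = (x - a) ^+ 2.
Proof.
move=> /fset_seq_neq0 a0; rewrite /sqdist.
by have [[a aa ->] _] := min_sqdist_attained x a0; exists a.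
Qed.

Lemma sqdist_le alpha x a : a \in alpha -> sqdist alpha x <= (x - a) ^+ 2.
Proof.
move=> aa; have a0 : (0 < #|` alpha|)%N by rewrite cardfs_gt0; apply/fset0Pn; exists a.
rewrite -lee_fin -min_sqdistE //.
by have [_ ->] := min_sqdist_attained x (fset_seq_neq0 a0).
Qed.

Lemma sqdist_ge0 alpha x : (0 < #|` alpha|)%N -> 0 <= sqdist alpha x.
Proof. by move=> /(sqdist_attained x)[a _ ->]; exact: sqr_ge0. Qed.

Lemma sqdist1 a x : sqdist [fset a]%fset x = (x - a) ^+ 2.
Proof.
have := @sqdist_attained [fset a]%fset x; rewrite cardfs1 => /(_ isT)[b].
by rewrite inE => /eqP ->.
Qed.

Lemma sqdist_subset alpha beta x : (0 < #|` alpha|)%N ->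
  (alpha `<=` beta)%fset -> sqdist beta x <= sqdist alpha x.
Proof.
by move=> /(sqdist_attained x)[a aa ->] /fsubsetP ab; exact/sqdist_le/ab.
Qed.

Lemma bounded_seq_sqdist alpha : (0 < #|` alpha|)%N ->
  bounded_seq (fun j => sqdist alpha j%:R^-1).
Proof.
move=> a0; have [a aa _] := sqdist_attained 0 a0.
have [M MP] := bounded_seq_sqrB a; exists M => j; apply: le_trans (MP j).
by rewrite !ger0_norm ?sqr_ge0 ?sqdist_ge0 // sqdist_le.
Qed.

Definition tail_distortion s alpha : R :=
  dyadic_sum s (fun j => sqdist alpha j%:R^-1).

Lemma tail_distortion_recl s alpha : (0 < #|` alpha|)%N ->
  tail_distortion s alpha =
  2^-1 ^+ s * sqdist alpha s%:R^-1 + tail_distortion s.+1 alpha.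
Proof.
move=> a0; rewrite /tail_distortion dyadic_sum_recl //.
exact: bounded_seq_sqdist.
Qed.

Lemma tail_distortion_ge0 s alpha : (0 < #|` alpha|)%N -> 0 <= tail_distortion s alpha.
Proof.
move=> a0; rewrite -(mulr0 (2 * 2^-1 ^+ s)) -dyadic_sum_cst.
apply: ler_dyadic_sum => [||j _]; [exact: bounded_seq_cst|exact: bounded_seq_sqdist|].
exact: sqdist_ge0.
Qed.

Lemma tail_distortion_subset s alpha beta : (0 < #|` alpha|)%N ->
  (alpha `<=` beta)%fset -> tail_distortion s beta <= tail_distortion s alpha.
Proof.
move=> a0 ab; have b0 := leq_trans a0 (fsubset_leq_card ab).
apply: ler_dyadic_sum => [||j _]; try exact: bounded_seq_sqdist.
exact: sqdist_subset.
Qed.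

Lemma tail_distortion1 s a : tail_distortion s [fset a]%fset =
  Er_oo R s + 2 * 2^-1 ^+ s * (a - Av_oo R s) ^+ 2.
Proof.
by rewrite -dyadic_sum_sqrB; apply: eq_dyadic_sum => j _; rewrite sqdist1.
Qed.

(** A relation and not a function, since ties are possible. *)
Definition nearest alpha x a := a \in alpha /\ sqdist alpha x = (x - a) ^+ 2.

(* If [1/s] belongs to the cell of [a] but [1/(s+1)] does not, then, cells being
   intervals, no later point does, and [a] can be dropped from there on. *)
Lemma nearest_next alpha s a : (0 < s)%N -> nearest alpha s%:R^-1 a ->
  nearest alpha s.+1%:R^-1 a \/
  [/\ (0 < #|` (alpha `\ a)%fset|)%N, #|` alpha| = #|` (alpha `\ a)%fset|.+1 &
      tail_distortion s.+1 alpha = tail_distortion s.+1 (alpha `\ a)%fset].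
Proof.
move=> s0 [aa sE]; have a0 : (0 < #|` alpha|)%N.
  by rewrite cardfs_gt0; apply/fset0Pn; exists a.
have [b ba bE] := sqdist_attained s.+1%:R^-1 a0.
have [le_ab|lt_ba] := leP ((s.+1%:R^-1 - a) ^+ 2) ((s.+1%:R^-1 - b) ^+ 2).
  by left; split=> //; apply/le_anti; rewrite sqdist_le //= bE.
have xx : s.+1%:R^-1 <= s%:R^-1 :> R by rewrite lef_pV2 ?posrE ?ltr0n // ler_nat.
have ab := sqdist_le s%:R^-1 ba; rewrite sE in ab.
have nab : b != a by apply: contraTneq lt_ba => ->; rewrite ltxx.
(* [b] beats [a] at [1/(s+1)] but not at the larger [1/s], so it lies to the left of [a], and it
   keeps beating [a] at all later points. *)
have {xx ab} ba_lt : b < a.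
  rewrite lt_neqAle nab /= leNgt; apply/negP => ab'.
  move: (s%:R^-1) (s.+1%:R^-1) xx ab lt_ba => x y xy h1 h2; nra.
have far j : (s < j)%N -> sqdist alpha j%:R^-1 < (j%:R^-1 - a) ^+ 2.
  move=> sj; apply: le_lt_trans (sqdist_le _ ba) _.
  have : j%:R^-1 <= s.+1%:R^-1 :> R.
    by rewrite lef_pV2 ?posrE ?ltr0n ?ler_nat //; apply: leq_trans sj.
  by move: lt_ba; move: (j%:R^-1) (s.+1%:R^-1) => z y h1 h2; nra.
right; have cE : #|` alpha| = #|` (alpha `\ a)%fset|.+1 by rewrite (cardfsD1 a) aa.
have bD : b \in (alpha `\ a)%fset by rewrite !inE nab.
have D0 : (0 < #|` (alpha `\ a)%fset|)%N by rewrite cardfs_gt0; apply/fset0Pn; exists b.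
split=> //; apply: eq_dyadic_sum => j sj; apply/le_anti/andP; split.
  by apply: sqdist_subset; rewrite ?fsubD1set // fsubsetU1.
have [c ca cE'] := sqdist_attained j%:R^-1 a0.
rewrite cE' sqdist_le // !inE ca andbT.
by apply: contraTneq (far _ sj) => ca'; rewrite cE' ca' ltxx.
Qed.

End TailDistortion.

(** * Optimal sets for the tails, by induction on the number of means *)

Section OptimalTails.
Variable R : realType.
Implicit Types (a b T : R) (alpha O : {fset R}) (s j k r : nat).

Local Notation W := (@tail_distortion R).

(** For at most [k] means on the points from [1/s] on, [T] is the least cost and [O] the only set
    attaining it. Uniqueness is built in because the induction has to carry it along. *)
Definition optimal_tail k s T O := [/\ (0 < #|` O| <= k)%N, W s O <= T &
  forall alpha, (0 < #|` alpha| <= k)%N ->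
    T <= W s alpha /\ (W s alpha <= T -> alpha = O)].

Lemma nearest_card alpha x a : nearest alpha x a -> (0 < #|` alpha|)%N.
Proof. by case=> aa _; rewrite cardfs_gt0; apply/fset0Pn; exists a. Qed.

Lemma tail_distortion_nearest alpha s a : nearest alpha s%:R^-1 a ->
  W s alpha = 2^-1 ^+ s * (s%:R^-1 - a) ^+ 2 + W s.+1 alpha.
Proof.
move=> na; rewrite tail_distortion_recl ?(nearest_card na) //.
by case: na => _ ->.
Qed.

Lemma optimal_tail1 s : optimal_tail 1 s (Er_oo R s) [fset Av_oo R s]%fset.
Proof.
have q0 : 0 < 2 * 2^-1 ^+ s :> R by rewrite mulr_gt0 ?expr_half_gt0.
split; first by rewrite cardfs1.
  by rewrite tail_distortion1 subrr expr0n /= mulr0 addr0.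
move=> alpha /anti_leq/esym/eqP/cardfs1P[a ->].
have m0 : 0 <= 2 * 2^-1 ^+ s * (a - Av_oo R s) ^+ 2 by rewrite mulr_ge0 ?sqr_ge0 // ltW.
rewrite tail_distortion1; split; first by rewrite lerDl.
rewrite gerDl pmulr_rle0 // => h.
have : (a - Av_oo R s) ^+ 2 == 0 by rewrite eq_le h sqr_ge0.
by rewrite sqrf_eq0 subr_eq0 => /eqP ->.
Qed.

(** By [nearest_next], a competitor that does not merge [1/s] with [1/(s+1)] leaves at most [k]
    means for the later points. It then costs at least [T] plus the term of [1/s], and equality
    forces that mean to be [1/s] and the others to form [O]. *)
Lemma optimal_tail_cons k s T O : (0 < s)%N -> optimal_tail k s.+1 T O ->
  (forall alpha a, (0 < #|` alpha| <= k.+1)%N -> nearest alpha s%:R^-1 a ->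
     nearest alpha s.+1%:R^-1 a -> T < W s alpha) ->
  optimal_tail k.+1 s T (s%:R^-1 |` O)%fset.
Proof.
move=> s0 [/andP[oc0 ock] WO optO] merged; split.
- rewrite cardfsU1; case: (_ \notin _); lia.
- rewrite tail_distortion_recl; last by rewrite cardfsU1; lia.
  have -> : sqdist (s%:R^-1 |` O)%fset s%:R^-1 = 0.
    apply/le_anti; rewrite sqdist_ge0 ?cardfsU1 ?andbT; last by lia.
    have := @sqdist_le _ (s%:R^-1 |` O)%fset s%:R^-1 s%:R^-1.
    by rewrite subrr expr0n /=; apply; rewrite !inE eqxx.
  rewrite mulr0 add0r (le_trans _ WO) // tail_distortion_subset //.
  exact: fsubsetUr.
move=> alpha /andP[a0 ak].
have [a aa aE] := sqdist_attained s%:R^-1 a0.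
have na : nearest alpha s%:R^-1 a by [].
have [na'|[D0 cD WD]] := nearest_next s0 na.
  have lt := merged _ _ (introT andP (conj a0 ak)) na na'.
  by split; [exact: ltW|rewrite leNgt lt].
have [|TD eqD] := optO (alpha `\ a)%fset; first by rewrite D0; lia.
rewrite (tail_distortion_nearest na) WD.
have q0 := expr_half_gt0 R s.
have m0 : 0 <= 2^-1 ^+ s * (s%:R^-1 - a) ^+ 2 by rewrite mulr_ge0 ?sqr_ge0 ?ltW.
split=> [|le_T]; first by rewrite (le_trans TD) // lerDr.
have OE : (alpha `\ a)%fset = O by apply: eqD; rewrite (le_trans _ le_T) // lerDr.
have : (s%:R^-1 - a) ^+ 2 == 0.
  rewrite eq_le sqr_ge0 andbT -(pmulr_rle0 _ q0).
  by have := le_trans le_T TD; rewrite gerDr.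
by rewrite sqrf_eq0 subr_eq0 -OE => /eqP ->; rewrite fsetD1K.
Qed.

Lemma optimal_tail_step k s T O : (0 < s)%N -> optimal_tail k s.+1 T O ->
  T < Er R s s.+1 -> optimal_tail k.+1 s T (s%:R^-1 |` O)%fset.
Proof.
move=> s0 optO ltT; apply: optimal_tail_cons => // alpha a /andP[a0 _] na na'.
apply: (lt_le_trans ltT); apply: le_trans (pair_cost_ge s a) _.
rewrite (tail_distortion_nearest na) (tail_distortion_nearest na') addrA lerDl.
exact: tail_distortion_ge0.
Qed.

Lemma optimal_tail2_small s : (0 < s <= 4)%N ->
  optimal_tail 2 s (Er_oo R s.+1) (s%:R^-1 |` [fset Av_oo R s.+1])%fset.
Proof.
move=> s04; have /andP[s0 s4] := s04.
apply: optimal_tail_cons (optimal_tail1 s.+1) _ => // alpha a /andP[a0 a2] na na1.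
rewrite (tail_distortion_nearest na) (tail_distortion_nearest na1).
have [na2|[D0 cD WD]] := nearest_next (ltn0Sn s) na1.
  rewrite (tail_distortion_nearest na2); apply: lt_le_trans (tail_lt_triple a s04) _.
  by rewrite !addrA lerDl tail_distortion_ge0.
rewrite WD; apply: lt_le_trans (tail_lt_pair a s04) _.
rewrite addrA lerD2l; have [_ _ opt1] := optimal_tail1 s.+2.
by have [|] := opt1 (alpha `\ a)%fset; first by rewrite D0; lia.
Qed.

(** The cases are how many of the points from [1/s] on share the mean of [1/s]. Two is optimal; one,
    three, and four or more are strictly worse by the cost comparisons. *)
Lemma optimal_tail2_large s : (5 <= s)%N ->
  optimal_tail 2 s (Er_oo R s.+2 + Er R s s.+1)
    (Av_oo R s.+2 |` [fset Av R s s.+1])%fset.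
Proof.
move=> s5; have s0 : (0 < s)%N by lia.
have q0 := expr_half_gt0 R s; have q1 := expr_half_gt0 R s.+1.
split.
- by rewrite cardfsU1 cardfs1; case: (_ \notin _).
- set O := (_ |` _)%fset; have O0 : (0 < #|` O|)%N by rewrite cardfsU1 cardfs1; lia.
  have OB : Av R s s.+1 \in O by rewrite !inE eqxx orbT.
  rewrite tail_distortion_recl // (tail_distortion_recl s.+1) //.
  have <- : tail_distortion s.+2 [fset Av_oo R s.+2]%fset = Er_oo R s.+2.
    by rewrite tail_distortion1 subrr expr0n /= mulr0 addr0.
  have := pair_cost s (Av R s s.+1); rewrite subrr expr0n /= mulr0 addr0 => <-.
  rewrite addrA addrC lerD //.
    by rewrite tail_distortion_subset ?cardfs1 // fsub1set !inE eqxx.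
  by rewrite lerD // ler_pM2l // sqdist_le.
move=> alpha /andP[a0 a2].
have [a aa aE] := sqdist_attained s%:R^-1 a0.
have na : nearest alpha s%:R^-1 a by [].
have strict V : Er_oo R s.+2 + Er R s s.+1 < V ->
    Er_oo R s.+2 + Er R s s.+1 <= V /\
    (V <= Er_oo R s.+2 + Er R s s.+1 ->
      alpha = (Av_oo R s.+2 |` [fset Av R s s.+1])%fset).
  by move=> lt; split; [exact: ltW|rewrite leNgt lt].
rewrite (tail_distortion_nearest na).
have m0 : 0 <= 2^-1 ^+ s * (s%:R^-1 - a) ^+ 2 by rewrite mulr_ge0 ?sqr_ge0 ?ltW.
have [na1|[D0 cD ->]] := nearest_next s0 na; last first.
  apply: strict; apply: lt_le_trans (pair_tail_lt_tail R s5) _.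
  have [_ _ opt1] := optimal_tail1 s.+1.
  have [|h _] := opt1 (alpha `\ a)%fset; first by rewrite D0; lia.
  by rewrite (le_trans h) // lerDr.
rewrite (tail_distortion_nearest na1).
have [na2|[D0 cD ->]] := nearest_next (ltn0Sn s) na1; last first.
  have [_ _ opt1] := optimal_tail1 s.+2.
  have [|TD eqD] := opt1 (alpha `\ a)%fset; first by rewrite D0; lia.
  rewrite addrA pair_cost.
  have c0 : 0 < 3 / 2 * 2^-1 ^+ s :> R by rewrite mulr_gt0 // divr_gt0.
  have n0 : 0 <= 3 / 2 * 2^-1 ^+ s * (a - Av R s s.+1) ^+ 2.
    by rewrite mulr_ge0 ?sqr_ge0 ?ltW.
  split=> [|le_T]; first by rewrite addrC lerD // lerDl.
  have DE : (alpha `\ a)%fset = [fset Av_oo R s.+2]%fset by apply: eqD; lra.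
  have : (a - Av R s s.+1) ^+ 2 == 0.
    rewrite eq_le sqr_ge0 andbT -(pmulr_rle0 _ c0); lra.
  rewrite sqrf_eq0 subr_eq0 => /eqP aAv.
  by rewrite -aAv -DE fsetUC fsetD1K.
rewrite (tail_distortion_nearest na2).
have [na3|[D0 cD ->]] := nearest_next (ltn0Sn s.+1) na2; last first.
  apply: strict; apply: lt_le_trans (pair_tail_lt_triple a s5) _.
  rewrite !addrA lerD2l.
  have [_ _ opt1] := optimal_tail1 s.+3.
  by have [|] := opt1 (alpha `\ a)%fset; first by rewrite D0; lia.
apply: strict; apply: lt_le_trans (pair_tail_lt_quadruple a s5) _.
by rewrite (tail_distortion_nearest na3) !addrA lerDl tail_distortion_ge0.
Qed.

(** The merge happens right before the final pair, so [pair_tail_lt_initial_pair] does not apply;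
    the cost beyond the merged points has to be counted as well. *)
Lemma optimal_tail3_large s : (4 <= s)%N ->
  optimal_tail 3 s (Er_oo R s.+3 + Er R s.+1 s.+2)
    (s%:R^-1 |` (Av_oo R s.+3 |` [fset Av R s.+1 s.+2]))%fset.
Proof.
move=> s4; have s0 : (0 < s)%N by lia.
apply: optimal_tail_cons (optimal_tail2_large _) _ => // alpha a /andP[a0 a3] na na1.
rewrite (tail_distortion_nearest na) (tail_distortion_nearest na1).
have [na2|[D0 cD WD]] := nearest_next (ltn0Sn s) na1.
  rewrite (tail_distortion_nearest na2).
  apply: lt_le_trans (pair_tail_lt_initial_triple a s4) _.
  by rewrite !addrA lerDl tail_distortion_ge0.
rewrite WD; apply: lt_le_trans (pair_tail_lt_pair a s4) _.
rewrite [leRHS]addrA lerD2l.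
have [|_ _ opt2] := @optimal_tail2_large s.+2; first by lia.
by have [|] := opt2 (alpha `\ a)%fset; first by rewrite D0; lia.
Qed.

Lemma unit_fractionsS r :
  unit_fractions R r.+1 = (r.+1%:R^-1 |` unit_fractions R r)%fset.
Proof.
have memS j : (j \in iota 1 r.+1) = (j == r.+1) || (j \in iota 1 r).
  by rewrite !mem_iota; lia.
apply/fsetP => x; rewrite !inE; apply/imfsetP/orP => [[j]|].
  move=> /= jr ->; have : j \in iota 1 r.+1 by [].
  by rewrite memS => /predU1P[->|jr']; [left|right; apply/imfsetP; exists j].
move=> [/eqP ->|/imfsetP[j /= jr ->]]; [exists r.+1|exists j] => //;
  by rewrite [_ \in _]memS ?eqxx ?jr ?orbT.
Qed.

(** Adds [1/r], ..., [1/2], [1] in turn. The cost [T] never changes, because each added mean sits on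
    its point. *)
Lemma optimal_tail_fractions r k T O : optimal_tail k r.+1 T O ->
  (forall s, (0 < s <= r)%N -> T < Er R s s.+1) ->
  optimal_tail (k + r) 1 T (O `|` unit_fractions R r)%fset.
Proof.
elim: r k O => [|r IH] k O optO ltT.
  rewrite addn0; have -> : unit_fractions R 0 = fset0.
    by apply/fsetP => x; rewrite inE; apply/imfsetP => -[].
  by rewrite fsetU0.
rewrite addnS -addSn unit_fractionsS fsetUCA fsetUA; apply: IH => [|s sr].
  by apply: optimal_tail_step => //; apply: ltT; rewrite leqnn.
by apply: ltT; lia.
Qed.

End OptimalTails.

(** * From the integral against [P] to the series over its atoms *)

Section Distortion.
Variable R : realType.
Implicit Types (P : probability (measurableTypeR R) R) (alpha O : {fset R}).

(** The shift makes every index an atom of [P]; without it index 0 would give the point 0, the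
    inverse of 0 being 0. *)
Local Notation atom := (fun k : nat => [set (k.+1%:R^-1 : R)]).

Lemma trivIset_atom : trivIset setT atom.
Proof.
apply/trivIsetP => i j _ _ ij; apply/seteqP; split=> // x [/= -> /invr_inj].
by move=> /eqP; rewrite eqr_nat eqSS (negbTE ij).
Qed.

Lemma measurable_atom k : measurable (atom k : set (measurableTypeR R)).
Proof. exact: measurable_set1. Qed.

Lemma nneseries_dyadic (g : nat -> R) : bounded_seq g ->
  (\sum_(i <oo) (2^-1 ^+ i.+1 * g i.+1)%:E = (dyadic_sum 1 g)%:E)%E.
Proof.
move=> bg; have c := @cvg_dyadic_sum R 1 _ bg.
have cS : (fun n => \sum_(1 <= j < n.+1) 2^-1 ^+ j * g j) @ \oo --> dyadic_sum 1 g.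
  by move: c; rewrite -cvg_shiftS.
rewrite -(cvg_lim _ cS) // -EFin_lim; last exact: cvgP cS.
by congr (lim (_ @ \oo)); apply/funext => n /=; rewrite sumEFin big_add1.
Qed.

Lemma measurable_min_sqdist (r : seq R) :
  measurable_fun setT ((fun x => \big[mine/+oo]_(a <- r) (`|x - a| ^+ 2)%:E)%E
    : measurableTypeR R -> \bar R).
Proof.
elim: r => [|a r IH].
  by under eq_fun do rewrite big_nil; exact: measurable_cst.
under eq_fun do rewrite big_cons; apply: measurable_mine => //.
apply: measurableT_comp => //; apply: measurable_funX.
by apply: measurableT_comp => //; exact: measurable_funB.
Qed.

(** The given masses sum to 1, so the complement of the atoms is negligible and the integral is a
    countable sum over singletons. *)
Lemma distortionE P alpha :
  (forall k, (1 <= k)%N -> P [set k%:R^-1] = (2^-1 ^+ k)%:E) ->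
  (0 < #|` alpha|)%N ->
  distortion P alpha = (tail_distortion 1 alpha)%:E.
Proof.
move=> hP a0; rewrite /distortion.
under eq_integral do rewrite min_sqdistE //.
have mf : measurable_fun setT
    ((fun x => (sqdist alpha x)%:E) : measurableTypeR R -> \bar R).
  by under eq_fun do rewrite -min_sqdistE //; exact: measurable_min_sqdist.
set S := \bigcup_k atom k.
have mS : measurable (S : set (measurableTypeR R)).
  by apply: bigcup_measurable => k _; exact: measurable_atom.
have PS : P S = 1%E.
  rewrite measure_bigcup; [|by move=> k _; exact: measurable_atom|exact: trivIset_atom].
  rewrite (_ : 1%E = (dyadic_sum 1 (fun=> 1 : R))%:E); last first.
    by rewrite dyadic_sum_cst expr1 mulr1 divff.
  rewrite -nneseries_dyadic; last exact: bounded_seq_cst.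
  congr (lim (_ @ \oo)); apply/funext => n.
  by apply: eq_big => [i|i _]; [rewrite in_setT|rewrite /= hP // mulr1].
have PSC : P (~` S) = 0%E by rewrite probability_setC // PS subee.
rewrite (@ge0_negligible_integral _ _ _ P _ (~` S)) //; first last.
- by move=> x _; rewrite lee_fin sqdist_ge0.
- exact: measurableC.
rewrite setTD setCK ge0_integral_bigcup //; first last.
- exact: trivIset_atom.
- by move=> x _; rewrite lee_fin sqdist_ge0.
- exact: measurable_funS mf.
rewrite /tail_distortion -nneseries_dyadic; last exact: bounded_seq_sqdist.
apply: eq_eseriesr => i _.
rewrite (eq_integral (cst (sqdist alpha i.+1%:R^-1)%:E)); last first.
  by move=> x; rewrite inE => /= ->.
rewrite integral_cst; last exact: measurable_atom.
by rewrite /= hP // -EFinM mulrC.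
Qed.

Lemma optimal_means_of_tail P n V O :
  (forall k, (1 <= k)%N -> P [set k%:R^-1] = (2^-1 ^+ k)%:E) ->
  optimal_tail n 1 V O ->
  (forall alpha, optimal_set_of_means P n alpha <-> alpha = O) /\
  quantization_error P n = V%:E.
Proof.
move=> hP [On WO optO].
have O0 : (0 < #|` O|)%N by case/andP: On.
have OV : distortion P O = V%:E.
  rewrite (distortionE hP) //; congr _%:E; apply/le_anti; rewrite WO /=.
  by have [] := optO O On.
have qV : quantization_error P n = V%:E.
  apply/le_anti/andP; split; first by rewrite -OV; apply: ereal_inf_lbound; exists O.
  apply: le_ereal_inf_tmp => _ [alpha an <-].
  have a0 : (0 < #|` alpha|)%N by case/andP: an.
  by rewrite (distortionE hP) // lee_fin; have [] := optO alpha an.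
split=> // alpha; split=> [[an]|->]; last by split=> //; rewrite OV qV.
have a0 : (0 < #|` alpha|)%N by case/andP: an.
rewrite (distortionE hP) // qV => -[aV].
by have [_] := optO alpha an; apply; rewrite aV.
Qed.

End Distortion.

Theorem theorem4p8 (R : realType) (P : probability (measurableTypeR R) R)
  (hP : forall k : nat, (1 <= k)%N -> P [set (k%:R^-1 : R)] = (2^-1 ^+ k)%:E) :
  (forall n : nat, (1 <= n <= 5)%N ->
     (forall alpha : {fset R},
        optimal_set_of_means P n alpha <->
        alpha = (Av_oo R n |` unit_fractions R n.-1)%fset) /\
     quantization_error P n = (Er_oo R n)%:E) /\
  (forall n : nat, (6 <= n <= 300)%N ->
     (forall alpha : {fset R},
        optimal_set_of_means P n alpha <->
        alpha = (Av_oo R n.+1 |` (Av R n.-1 n |` unit_fractions R n.-2))%fset) /\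
     quantization_error P n = (Er_oo R n.+1 + Er R n.-1 n)%:E).
Proof.
split=> n /andP[n_ge n_le]; apply: optimal_means_of_tail => //.
  case: n n_ge n_le => [//|[|n]] _ n5.
    by apply: (optimal_tail_fractions (optimal_tail1 R 1)) => -[].
  (* Now [n] is the number of means less 2: a two-mean tail starts at [1/(n+1)], with [n+1 <= 4],
     and the [n] larger fractions are added. *)
  rewrite unit_fractionsS fsetUCA fsetUA -[X in optimal_tail X]/(2 + n)%N.
  apply: optimal_tail_fractions; first by apply: optimal_tail2_small; lia.
  by move=> s sn; apply: tail_lt_initial_pair; lia.
case: n n_ge {n_le} => [//|[//|[//|n]]] n6.
(* Now [n] is the number of means less 3: a three-mean tail starts at [1/(n+1)], with [n+1 >= 4]. *)
rewrite unit_fractionsS fsetUA fsetUCA fsetUA -[X in optimal_tail X]/(3 + n)%N.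
apply: optimal_tail_fractions; first by apply: optimal_tail3_large; lia.
by move=> s sn; apply: pair_tail_lt_initial_pair; lia.
Qed.
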